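(* Fix $\gamma>0$ and, for $0<\epsilon<1$, let $T=T(\epsilon)$ be given by $\gamma=\epsilon\sqrt T$. Let $u$ be the function defined in the context with $\sigma=\kappa=1-\epsilon^2$ and with a constant $b=b(\epsilon)>0$ whose leading order term as $\epsilon\to0$ is $\frac1\epsilon$ (i.e. $\epsilon b(\epsilon)\to1$). Then $$\lim_{\epsilon\to0}\frac1{\sqrt T}\,u(0,(\epsilon T,\epsilon T),-T)=c(\gamma),$$ where $$c(\gamma)=\frac1{\sqrt\pi}e^{-\gamma^2}+\gamma\,\mathrm{erf}(\gamma)+\Big(\frac1\gamma-\gamma\Big)\mathrm{erf}\Big(\frac{\gamma}{\sqrt2}\Big)-\sqrt{\frac2\pi}\,e^{-\gamma^2/2}.$$
   Context: $\mathrm{erf}(y)=\frac2{\sqrt\pi}\int_0^ye^{-s^2}ds$. With $\kappa=1-\epsilon^2$ and parameters $\sigma,b>0$, for $\eta\in\mathbb R$, $\xi=(\xi^h,\xi^r)\in\mathbb R^2$, $t<0$ let $$u(\eta,\xi,t)=u^h(\eta,\xi^r+\xi^h,t)+u^n(\xi^r,t),$$ $$u^h(\eta,z,t)=\frac12\Big(\eta+\int_{\mathbb R}\Phi(z-s,2t)|s|\,ds\Big),\qquad \Phi(s,t)=\frac1{\sqrt{-2\pi\kappa t}}\exp\Big(\frac{s^2}{2\kappa t}\Big),$$ $$u^n(\xi^r,t)=\varphi(\xi^r+\epsilon t)-\hat\varphi(\xi^r,t),\qquad \hat\varphi(\xi^r,t)=\int_{\mathbb R}\Phi(\xi^r-s,t)\varphi(s)\,ds,$$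 with $\varphi(y)=-y$ for $y\le0$ and $\varphi(y)=y+b e^{-2\epsilon y/\sigma}-b$ for $y>0$. *)

(* Defs.v *)
From Stdlib Require Import Reals.
From Coquelicot Require Import Coquelicot.
Open Scope R_scope.

Definition erf (y : R) : R :=
  2 / sqrt PI * RInt (fun s => exp (- s ^ 2)) 0 y.

(* Improper Riemann integral over the real line: the two endpoints tend to
   -oo and +oo independently.  The integrands below are continuous with
   Gaussian decay, so this agrees with the Lebesgue integral. *)
Definition RInt_line (f : R -> R) : R :=
  RInt_gen f (Rbar_locally m_infty) (Rbar_locally p_infty).

Definition kappa (eps : R) : R := 1 - eps ^ 2.

(* Only meant for t < 0, where it is the centred Gaussian density
   of variance - kappa eps * t. *)
Definition Phi (eps s t : R) : R :=
  1 / sqrt (- 2 * PI * kappa eps * t) * exp (s ^ 2 / (2 * kappa eps * t)).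

Definition phi (eps sigma b y : R) : R :=
  if Rle_dec y 0 then - y else y + b * exp (- 2 * eps * y / sigma) - b.

Definition phi_hat (eps sigma b xr t : R) : R :=
  RInt_line (fun s => Phi eps (xr - s) t * phi eps sigma b s).

Definition uh (eps eta z t : R) : R :=
  1 / 2 * (eta + RInt_line (fun s => Phi eps (z - s) (2 * t) * Rabs s)).

Definition un (eps sigma b xr t : R) : R :=
  phi eps sigma b (xr + eps * t) - phi_hat eps sigma b xr t.

(* The pair xi is (xi^h, xi^r), in this order. *)
Definition u (eps sigma b eta : R) (xi : R * R) (t : R) : R :=
  uh eps eta (snd xi + fst xi) t + un eps sigma b (snd xi) t.

Definition c (gamma : R) : R :=
  1 / sqrt PI * exp (- gamma ^ 2) + gamma * erf gamma
  + (1 / gamma - gamma) * erf (gamma / sqrt 2)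
  - sqrt (2 / PI) * exp (- gamma ^ 2 / 2).

(* Main.v *)
Require Import Defs.
From Stdlib Require Import Reals.
From Coquelicot Require Import Coquelicot.
From Stdlib Require Import ssreflect Lra Psatz FunctionalExtensionality.
Open Scope R_scope.

(** Both line integrals are Gaussian expectations, of [|Y|] and of
    [|Y| + b (e^{-2 eps Y / sigma} - 1) 1_{Y > 0}].  With [sigma = kappa] the
    exponential factor is exactly the tilt that reflects the mean of [Y], so the
    second one also reduces to [erf] and a Gaussian.  This gives a closed form in
    [kappa] and [eps * b] valid for every [eps], and the limit follows by
    continuity at [kappa = eps * b = 1].  The value [erf (+oo) = 1] comes from the
    constancy of [(int_0^x e^{-s^2} ds)^2 + int_0^1 e^{-x^2(1+t^2)}/(1+t^2) dt]. *)

(** * The Gaussian integral and its square *)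

Lemma continuous_gauss (x : R) : continuous (fun s => exp (- s ^ 2)) x.
Proof. apply: ex_derive_continuous; auto_derive; trivial. Qed.

Lemma ex_RInt_gauss (x y : R) : ex_RInt (fun s => exp (- s ^ 2)) x y.
Proof. apply: ex_RInt_continuous => z _; apply continuous_gauss. Qed.

Lemma is_derive_RInt_gauss (x : R) :
  is_derive (fun y => RInt (fun s => exp (- s ^ 2)) 0 y) x (exp (- x ^ 2)).
Proof.
apply (is_derive_RInt (fun s => exp (- s ^ 2)) _ 0); last exact: continuous_gauss.
by apply filter_forall => y; exact: (RInt_correct _ _ _ (ex_RInt_gauss 0 y)).
Qed.

Lemma is_RInt_antiderivative (F f : R -> R) (a b l : R) :
  (forall x, Rmin a b <= x <= Rmax a b -> is_derive F x (f x)) ->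
  (forall x, Rmin a b <= x <= Rmax a b -> continuous f x) ->
  l = F b - F a -> is_RInt f a b l.
Proof. by move=> HF Hf ->; exact: (is_RInt_derive F). Qed.

(** For [0 <= x] this is the integral of e^{-u^2-v^2} over the part of the first quadrant outside
    the square [0,x]^2, written in polar coordinates with t = tan(theta) and the two halves about
    the diagonal merged. *)
Definition polar_int (x : R) : R :=
  RInt (fun t => exp (- (x ^ 2 * (1 + t ^ 2))) / (1 + t ^ 2)) 0 1.

Lemma ex_RInt_polar (x : R) :
  ex_RInt (fun t => exp (- (x ^ 2 * (1 + t ^ 2))) / (1 + t ^ 2)) 0 1.
Proof.
apply: ex_RInt_continuous => t _; apply: ex_derive_continuous; auto_derive.
nra.
Qed.

Lemma polar_int_0 : polar_int 0 = PI / 4.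
Proof.
rewrite -atan_1 /polar_int.
apply: is_RInt_unique.
apply: (is_RInt_ext (fun t => / (1 + t ^ 2))).
  move=> t _; rewrite (_ : - (0 ^ 2 * (1 + t ^ 2)) = 0); last by ring.
  by rewrite exp_0 /Rdiv Rmult_1_l.
apply (is_RInt_antiderivative atan); last by rewrite atan_0; ring.
  by move=> t _; auto_derive => //; rewrite /=; field; nra.
move=> t _; apply: ex_derive_continuous; auto_derive; nra.
Qed.

(** Since 1 + t^2 >= 1, the integrand never exceeds e^{-x^2}. This squeezes [polar_int] to 0 at
    infinity. *)
Lemma polar_int_bounds (x : R) : 0 <= polar_int x <= exp (- x ^ 2).
Proof.
have H t : 0 <= exp (- (x ^ 2 * (1 + t ^ 2))) / (1 + t ^ 2) <= exp (- x ^ 2).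
  have Ht : 0 < 1 + t ^ 2 by nra.
  have He := exp_pos (- (x ^ 2 * (1 + t ^ 2))).
  split; first by apply Rlt_le, Rdiv_lt_0_compat.
  apply/Rle_div_l => //.
  have : exp (- (x ^ 2 * (1 + t ^ 2))) <= exp (- x ^ 2).
    have [Hlt|->] : - (x ^ 2 * (1 + t ^ 2)) <= - x ^ 2 by nra.
      exact: Rlt_le (exp_increasing _ _ Hlt).
    exact: Rle_refl.
  have := exp_pos (- x ^ 2); nra.
split.
  by apply: RInt_ge_0; [lra | exact: ex_RInt_polar | move=> t _; case: (H t)].
rewrite -[X in _ <= X](_ : RInt (fun _ => exp (- x ^ 2)) 0 1 = _);
  last by rewrite RInt_const /scal /= /mult /=; ring.
apply: RInt_le; [lra | exact: ex_RInt_polar | exact: ex_RInt_const |].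
by move=> t _; case: (H t).
Qed.

(** Differentiating under the integral sign cancels the denominator 1 + t^2; what remains factors as
    e^{-x^2} times a Gaussian in x t, and the factor x is absorbed by the substitution s = x t. *)
Lemma is_derive_polar_int (x : R) :
  is_derive polar_int x
    (- 2 * exp (- x ^ 2) * RInt (fun s => exp (- s ^ 2)) 0 x).
Proof.
have HD y t : is_derive (fun z => exp (- (z ^ 2 * (1 + t ^ 2))) / (1 + t ^ 2)) y
                (- 2 * y * exp (- (y ^ 2 * (1 + t ^ 2)))).
  auto_derive; first nra.
  by rewrite /=; field; nra.
have -> : - 2 * exp (- x ^ 2) * RInt (fun s => exp (- s ^ 2)) 0 x =
    RInt (fun t => Derive (fun z => exp (- (z ^ 2 * (1 + t ^ 2))) / (1 + t ^ 2)) x) 0 1.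
  (* The substitution s = x t + 0 carries [0,1] to [0,x]. *)
  have HL := RInt_comp_lin _ x 0 0 1 (ex_RInt_gauss (x * 0 + 0) (x * 1 + 0)).
  have HX := ex_RInt_comp_lin _ x 0 0 1 (ex_RInt_gauss (x * 0 + 0) (x * 1 + 0)).
  transitivity (RInt (fun t => scal (- 2 * exp (- x ^ 2))
                              (scal x (exp (- (x * t + 0) ^ 2)))) 0 1).
    by rewrite (RInt_scal _ _ _ _ HX) HL Rmult_0_r !Rplus_0_r Rmult_1_r.
  apply: RInt_ext => t _; rewrite (is_derive_unique _ _ _ (HD x t)) /scal /= /mult /=.
  rewrite (_ : - (x * (x * 1) * (1 + t * (t * 1))) =
     - (x * (x * 1)) + - ((x * t + 0) * ((x * t + 0) * 1))); last by ring.
  rewrite exp_plus; ring.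
apply: (is_derive_RInt_param (fun z t => exp (- (z ^ 2 * (1 + t ^ 2))) / (1 + t ^ 2))).
- by apply filter_forall => y t _; exists (- 2 * y * exp (- (y ^ 2 * (1 + t ^ 2)))).
- move=> t _.
  apply: (continuity_2d_pt_ext (fun u v => - 2 * u * exp (- (u ^ 2 * (1 + v ^ 2))))).
    by move=> y s; rewrite (is_derive_unique _ _ _ (HD y s)).
  apply: continuity_2d_pt_mult.
    by apply: continuity_2d_pt_mult;
      [apply continuity_2d_pt_const | apply continuity_2d_pt_id1].
  apply: continuity_1d_2d_pt_comp;
    first by apply derivable_continuous_pt, derivable_pt_exp.
  apply: continuity_2d_pt_opp.
  rewrite /=.
  by repeat first [apply: continuity_2d_pt_mult | apply: continuity_2d_pt_plus |
     apply: continuity_2d_pt_const | apply: continuity_2d_pt_id1 | apply: continuity_2d_pt_id2].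
- by apply filter_forall => y; exact: ex_RInt_polar.
Qed.

(** The square and [polar_int] have opposite derivatives, so their sum keeps its value at 0, which
    is PI / 4. *)
Lemma sqr_RInt_gauss (x : R) : 0 <= x ->
  RInt (fun s => exp (- s ^ 2)) 0 x ^ 2 = PI / 4 - polar_int x.
Proof.
case=> [Hx|<-]; last by rewrite RInt_point polar_int_0 /zero /=; lra.
suff : RInt (fun s => exp (- s ^ 2)) 0 0 ^ 2 + polar_int 0 =
       RInt (fun s => exp (- s ^ 2)) 0 x ^ 2 + polar_int x.
  by rewrite RInt_point polar_int_0 /zero /=; lra.
apply: (eq_is_derive (fun y => RInt (fun s => exp (- s ^ 2)) 0 y ^ 2 + polar_int y)) => // t _.
have H1 := is_derive_pow _ 2 _ _ (is_derive_RInt_gauss t).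
have := is_derive_plus _ _ _ _ _ H1 (is_derive_polar_int t).
have -> : zero = plus
    (INR 2 * exp (- t ^ 2) * RInt (fun s => exp (- s ^ 2)) 0 t ^ Nat.pred 2)
    (- 2 * exp (- t ^ 2) * RInt (fun s => exp (- s ^ 2)) 0 t) => //.
by rewrite /zero /plus /=; ring.
Qed.

(** * Limits of the Gaussian and of [erf] at infinity *)

Lemma is_lim_gauss_p : is_lim (fun x => exp (- x ^ 2)) p_infty 0.
Proof.
apply: (is_lim_comp exp _ _ _ m_infty); first exact: is_lim_exp_m.
  have H : is_lim (fun x => - (x * x)) p_infty (Rbar_opp (Rbar_mult p_infty p_infty)).
    by apply: is_lim_opp; apply: is_lim_mult => //; apply: is_lim_id.
  by apply: is_lim_ext H => x; ring.
by exists 0.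
Qed.

Lemma is_lim_comp_opp (f : R -> R) (l : Rbar) :
  is_lim f p_infty l -> is_lim (fun x => f (- x)) m_infty l.
Proof.
move=> H; apply: (is_lim_comp f _ _ _ p_infty) => //; last by exists 0.
exact: (is_lim_opp _ m_infty m_infty (is_lim_id _)).
Qed.

Lemma is_lim_gauss_m : is_lim (fun x => exp (- x ^ 2)) m_infty 0.
Proof.
apply: is_lim_ext (is_lim_comp_opp _ _ is_lim_gauss_p) => x.
by congr exp; ring.
Qed.

Lemma sqrt_PI_pos : 0 < sqrt PI.
Proof. by apply sqrt_lt_R0, PI_RGT_0. Qed.

Lemma is_derive_erf (x : R) : is_derive erf x (2 / sqrt PI * exp (- x ^ 2)).
Proof. by apply: is_derive_scal; apply is_derive_RInt_gauss. Qed.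

Lemma continuous_erf (x : R) : continuous erf x.
Proof. by apply: ex_derive_continuous; eexists; apply is_derive_erf. Qed.

Lemma erf_opp (x : R) : erf (- x) = - erf x.
Proof.
rewrite /erf.
have := RInt_comp_lin (fun s => exp (- s ^ 2)) (-1) 0 0 x (ex_RInt_gauss _ _).
rewrite (_ : -1 * 0 + 0 = 0); last by ring.
rewrite (_ : -1 * x + 0 = - x); last by ring.
move=> <-.
rewrite (RInt_ext _ (fun s => scal (-1) (exp (- s ^ 2)))).
  by rewrite RInt_scal; [rewrite /scal /= /mult /=; ring | exact: ex_RInt_gauss].
by move=> s _; congr (scal _ (exp _)); ring.
Qed.

(** For x > 0 the integral in [erf] is nonnegative, hence is the square root of PI / 4 -
    [polar_int x], and [polar_int x] tends to 0. *)
Lemma is_lim_erf_p : is_lim erf p_infty 1.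
Proof.
have HP := sqrt_PI_pos.
have H : is_lim (fun x => 2 / sqrt PI * sqrt (PI / 4 - polar_int x)) p_infty 1.
  have E : 1 = 2 / sqrt PI * sqrt (PI / 4 - 0).
    rewrite Rminus_0_r sqrt_div_alt; last lra.
    rewrite (_ : 4 = 2 ^ 2); last ring.
    by rewrite sqrt_pow2; [field; lra | lra].
  rewrite E.
  apply: (is_lim_comp_continuous polar_int
    (fun k => 2 / sqrt PI * sqrt (PI / 4 - k)) _ 0).
    apply: (is_lim_le_le_loc (fun _ => 0) (fun x => exp (- x ^ 2))).
    - by apply filter_forall => x; apply polar_int_bounds.
    - exact: is_lim_const.
    - exact: is_lim_gauss_p.
  (* The square root is differentiable here because PI / 4 - 0 is positive. *)
  apply: ex_derive_continuous; auto_derive.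
  by have := PI_RGT_0; lra.
apply: is_lim_ext_loc H; exists 0 => x Hx.
rewrite /erf -sqr_RInt_gauss; last lra.
rewrite sqrt_pow2 //; apply: RInt_ge_0; [lra | exact: ex_RInt_gauss |].
by move=> s _; apply Rlt_le, exp_pos.
Qed.

Lemma is_lim_erf_m : is_lim erf m_infty (-1).
Proof.
have := is_lim_opp _ _ _ (is_lim_comp_opp _ _ is_lim_erf_p).
by apply: is_lim_ext => x; rewrite erf_opp Ropp_involutive.
Qed.

(** * Improper integrals through antiderivatives *)

Lemma is_RInt_gen_antiderivative (F f : R -> R) (Fa Fb : (R -> Prop) -> Prop)
  {FFa : Filter Fa} {FFb : Filter Fb} (la lb : R) :
  filter_prod Fa Fb (fun ab => is_RInt f (fst ab) (snd ab) (F (snd ab) - F (fst ab))) ->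
  filterlim F Fa (locally la) -> filterlim F Fb (locally lb) ->
  is_RInt_gen f Fa Fb (lb - la).
Proof.
move=> Hf Ha Hb P HP.
have H : filterlim (fun ab => F (snd ab) - F (fst ab)) (filter_prod Fa Fb) (locally (lb - la)).
  apply: (filterlim_comp_2 (fun ab => F (snd ab)) (fun ab => - F (fst ab)) Rplus).
  - exact: (filterlim_comp _ _ _ snd F _ _ _ filterlim_snd Hb).
  - apply: (filterlim_comp _ _ _ (fun ab => F (fst ab)) Ropp _ (locally la)).
      exact: (filterlim_comp _ _ _ fst F _ _ _ filterlim_fst Ha).
    exact: (filterlim_opp la).
  - exact: (filterlim_plus lb (- la)).
have HPab : filter_prod Fa Fb (fun ab => P (F (snd ab) - F (fst ab))) by exact: H.
apply: filter_imp (filter_and _ _ Hf HPab) => ab [H1 H2].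
by exists (F (snd ab) - F (fst ab)).
Qed.

Lemma RInt_line_ext (f g : R -> R) : (forall x, f x = g x) -> RInt_line f = RInt_line g.
Proof.
by move=> H; congr RInt_line; apply: functional_extensionality.
Qed.

(** The integrands of interest have a kink at 0, so each half-line gets its own smooth extension and
    antiderivative. Agreement on the open half-lines suffices, as one point does not affect the
    integral. *)
Lemma RInt_line_split_at_0 (f F1 f1 F2 f2 : R -> R) (L1 L2 : R) :
  (forall x, x < 0 -> f x = f1 x) -> (forall x, 0 < x -> f x = f2 x) ->
  (forall x, is_derive F1 x (f1 x)) -> (forall x, is_derive F2 x (f2 x)) ->
  (forall x, continuous f1 x) -> (forall x, continuous f2 x) ->
  is_lim F1 m_infty L1 -> is_lim F2 p_infty L2 ->
  RInt_line f = (F1 0 - L1) + (L2 - F2 0).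
Proof.
move=> E1 E2 D1 D2 C1 C2 l1 l2.
(* Taking [at_point 0] as the finite end puts both halves in the scope of the filter version of the
   fundamental theorem. *)
have at0 (F : R -> R) : filterlim F (at_point 0) (locally (F 0)).
  by move=> P HP; exact: locally_singleton.
have Hl : is_RInt_gen f (Rbar_locally m_infty) (at_point 0) (F1 0 - L1).
  apply (is_RInt_gen_antiderivative F1 _ _ _) => //.
  apply: (Filter_prod _ _ _ (fun x => x < 0) (fun x => x = 0)); [by exists 0 | done |].
  move=> x _ Hx -> /=.
  apply: (is_RInt_ext f1).
    by rewrite Rmin_left ?Rmax_right; try lra; move=> y Hy; rewrite E1; lra.
  by apply (is_RInt_antiderivative F1).
have Hr : is_RInt_gen f (at_point 0) (Rbar_locally p_infty) (L2 - F2 0).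
  apply (is_RInt_gen_antiderivative F2 _ _ _) => //.
  apply: (Filter_prod _ _ _ (fun x => x = 0) (fun x => 0 < x)); [done | by exists 0 |].
  move=> _ x -> Hx /=.
  apply: (is_RInt_ext f2).
    by rewrite Rmin_left ?Rmax_right; try lra; move=> y Hy; rewrite E2; lra.
  by apply (is_RInt_antiderivative F2).
exact: (is_RInt_gen_unique _ _ (is_RInt_gen_Chasles _ _ _ _ Hl Hr)).
Qed.

(** * Normal densities and their antiderivatives *)

(* Density of the normal law of mean [m] and variance [a ^ 2 / 2]. *)
Definition normal_pdf (m a y : R) : R :=
  1 / (sqrt PI * a) * exp (- ((y - m) / a) ^ 2).

(* Shifted by 1/2 from the distribution function, so as to be odd about [m]. *)
Definition normal_cdf (m a y : R) : R := 1 / 2 * erf ((y - m) / a).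

(** An antiderivative of y times the density: write y = m + (y - m) and note that (y - m) times the
    density is the derivative of -a^2/2 times the density. *)
Definition normal_moment (m a y : R) : R :=
  m * normal_cdf m a y - a ^ 2 / 2 * normal_pdf m a y.

Lemma continuous_normal_pdf (m a x : R) : 0 < a -> continuous (normal_pdf m a) x.
Proof. by move=> Ha; apply: ex_derive_continuous; rewrite /normal_pdf; auto_derive. Qed.

Lemma is_derive_normal_cdf (m a x : R) : 0 < a ->
  is_derive (normal_cdf m a) x (normal_pdf m a x).
Proof.
move=> Ha; have HP := sqrt_PI_pos.
have H1 : is_derive (fun y => (y - m) / a) x (/ a) by auto_derive => //; ring.
have H := is_derive_scal _ _ (1 / 2) _ (is_derive_comp _ _ _ _ _ (is_derive_erf _) H1).
suff <- : 1 / 2 * scal (/ a) (2 / sqrt PI * exp (- ((x - m) / a) ^ 2)) = normal_pdf m a x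
  by exact: H.
by rewrite /normal_pdf /scal /= /mult /=; field; lra.
Qed.

Lemma is_derive_normal_moment (m a x : R) : 0 < a ->
  is_derive (normal_moment m a) x (x * normal_pdf m a x).
Proof.
move=> Ha; have HP := sqrt_PI_pos.
have H1 := is_derive_scal _ _ m _ (is_derive_normal_cdf m a x Ha).
have H2 : is_derive (fun y => a ^ 2 / 2 * normal_pdf m a y) x ((m - x) * normal_pdf m a x).
  rewrite /normal_pdf; auto_derive => //.
  by rewrite /= /Rdiv /Rminus; field; lra.
have H := is_derive_minus _ _ _ _ _ H1 H2.
suff <- : minus (m * normal_pdf m a x) ((m - x) * normal_pdf m a x) = x * normal_pdf m a x
  by exact: H.
by rewrite /minus /plus /opp /=; ring.
Qed.

Lemma is_lim_affine_p (m a : R) : 0 < a -> is_lim (fun y => (y - m) / a) p_infty p_infty.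
Proof.
move=> Ha.
apply: (is_lim_ext (fun y => / a * y + - m / a)); first by move=> y; rewrite /Rdiv; ring.
have Hi : 0 < / a by apply Rinv_0_lt_compat.
apply: is_lim_plus; [apply: is_lim_scal_l; exact: is_lim_id | exact: is_lim_const |].
rewrite /is_Rbar_plus /= ; case: Rle_dec => [h|]; last lra.
by case: Rle_lt_or_eq_dec => [_|]; [|lra].
Qed.

Lemma is_lim_affine_m (m a : R) : 0 < a -> is_lim (fun y => (y - m) / a) m_infty m_infty.
Proof.
move=> Ha; have := is_lim_opp _ _ _ (is_lim_comp_opp _ _ (is_lim_affine_p (- m) a Ha)).
by apply: is_lim_ext => y; field; lra.
Qed.

Lemma is_lim_comp_affine_p (f : R -> R) (m a : R) (l : Rbar) : 0 < a ->
  is_lim f p_infty l -> is_lim (fun y => f ((y - m) / a)) p_infty l.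
Proof.
move=> Ha Hf; apply (is_lim_comp f (fun y => (y - m) / a) _ _ p_infty) => //.
  exact: is_lim_affine_p.
by exists 0.
Qed.

Lemma is_lim_comp_affine_m (f : R -> R) (m a : R) (l : Rbar) : 0 < a ->
  is_lim f m_infty l -> is_lim (fun y => f ((y - m) / a)) m_infty l.
Proof.
move=> Ha Hf; apply (is_lim_comp f (fun y => (y - m) / a) _ _ m_infty) => //.
  exact: is_lim_affine_m.
by exists 0.
Qed.

Lemma is_lim_normal_cdf_p (m a : R) : 0 < a -> is_lim (normal_cdf m a) p_infty (1 / 2).
Proof.
move=> Ha.
have H := is_lim_comp_affine_p _ m a _ Ha is_lim_erf_p.
have := is_lim_scal_l _ (1 / 2) _ _ H.
by rewrite /= Rmult_1_r.
Qed.

Lemma is_lim_normal_cdf_m (m a : R) : 0 < a -> is_lim (normal_cdf m a) m_infty (- (1 / 2)).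
Proof.
move=> Ha.
have H := is_lim_comp_affine_m _ m a _ Ha is_lim_erf_m.
have := is_lim_scal_l _ (1 / 2) _ _ H.
by rewrite /= (_ : 1 / 2 * -1 = - (1 / 2)); last by ring.
Qed.

Lemma is_lim_normal_pdf_p (m a : R) : 0 < a -> is_lim (normal_pdf m a) p_infty 0.
Proof.
move=> Ha.
have H := is_lim_comp_affine_p _ m a _ Ha is_lim_gauss_p.
have := is_lim_scal_l _ (1 / (sqrt PI * a)) _ _ H.
by rewrite /= Rmult_0_r.
Qed.

Lemma is_lim_normal_pdf_m (m a : R) : 0 < a -> is_lim (normal_pdf m a) m_infty 0.
Proof.
move=> Ha.
have H := is_lim_comp_affine_m _ m a _ Ha is_lim_gauss_m.
have := is_lim_scal_l _ (1 / (sqrt PI * a)) _ _ H.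
by rewrite /= Rmult_0_r.
Qed.

Lemma is_lim_normal_moment_p (m a : R) : 0 < a ->
  is_lim (normal_moment m a) p_infty (m / 2).
Proof.
move=> Ha.
rewrite (_ : m / 2 = m * (1 / 2) - a ^ 2 / 2 * 0); last by field.
apply: is_lim_minus'.
- exact: (is_lim_scal_l _ m _ _ (is_lim_normal_cdf_p m a Ha)).
- exact: (is_lim_scal_l _ (a ^ 2 / 2) _ _ (is_lim_normal_pdf_p m a Ha)).
Qed.

Lemma is_lim_normal_moment_m (m a : R) : 0 < a ->
  is_lim (normal_moment m a) m_infty (- (m / 2)).
Proof.
move=> Ha.
rewrite (_ : - (m / 2) = m * - (1 / 2) - a ^ 2 / 2 * 0); last by field.
apply: is_lim_minus'.
- exact: (is_lim_scal_l _ m _ _ (is_lim_normal_cdf_m m a Ha)).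
- exact: (is_lim_scal_l _ (a ^ 2 / 2) _ _ (is_lim_normal_pdf_m m a Ha)).
Qed.

Lemma normal_cdf_at_0 (m a : R) : normal_cdf m a 0 = - (1 / 2 * erf (m / a)).
Proof.
rewrite /normal_cdf (_ : (0 - m) / a = - (m / a)); last by rewrite /Rdiv; ring.
rewrite erf_opp; ring.
Qed.

Lemma normal_moment_at_0 (m a : R) : 0 < a ->
  normal_moment m a 0 =
  - (1 / 2) * (m * erf (m / a) + a / sqrt PI * exp (- (m / a) ^ 2)).
Proof.
move=> Ha; have HP := sqrt_PI_pos.
rewrite /normal_moment normal_cdf_at_0 /normal_pdf.
rewrite (_ : - ((0 - m) / a) ^ 2 = - (m / a) ^ 2); last by field; lra.
field; lra.
Qed.

Lemma continuous_mul_normal_pdf (m a x : R) : 0 < a ->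
  continuous (fun y => y * normal_pdf m a y) x.
Proof.
by move=> Ha; apply: continuous_mult;
  [exact: continuous_id | exact: continuous_normal_pdf].
Qed.

(** * The two Gaussian expectations *)

Lemma RInt_line_normal_abs (m a : R) : 0 < a ->
  RInt_line (fun s => normal_pdf m a s * Rabs s) =
  m * erf (m / a) + a / sqrt PI * exp (- (m / a) ^ 2).
Proof.
move=> Ha.
(* The contributions of the two infinite ends cancel, leaving -2 [normal_moment m a 0]. *)
rewrite (RInt_line_split_at_0 _
  (fun x => - normal_moment m a x) (fun x => - (x * normal_pdf m a x))
  (normal_moment m a) (fun x => x * normal_pdf m a x) (- - (m / 2)) (m / 2)).
- by rewrite normal_moment_at_0 //; field; have := sqrt_PI_pos; lra.
- by move=> x Hx; rewrite Rabs_left //; ring.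
- by move=> x Hx; rewrite Rabs_pos_eq; [ring | lra].
- by move=> x; apply: is_derive_opp; exact: is_derive_normal_moment.
- by move=> x; exact: is_derive_normal_moment.
- by move=> x; apply: continuous_opp; exact: continuous_mul_normal_pdf.
- by move=> x; exact: continuous_mul_normal_pdf.
- exact: (is_lim_opp _ _ _ (is_lim_normal_moment_m m a Ha)).
- exact: is_lim_normal_moment_p.
Qed.

(** Completing the square: (x - m)^2 + 4 m x = (x + m)^2. *)
Lemma normal_pdf_tilt (m a x : R) : 0 < a ->
  exp (- (4 * m / a ^ 2) * x) * normal_pdf m a x = normal_pdf (- m) a x.
Proof.
move=> Ha; rewrite /normal_pdf -Rmult_assoc [exp _ * _]Rmult_comm Rmult_assoc -exp_plus.
by congr (_ * exp _); field; lra.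
Qed.

(* The hypothesis on [m] makes the exponential tilt in [phi] turn the normal
   law of mean [m] into the one of mean [- m]. *)
Lemma RInt_line_normal_phi (eps sigma b m a : R) : 0 < a -> sigma <> 0 ->
  2 * m * sigma = eps * a ^ 2 ->
  RInt_line (fun s => normal_pdf m a s * phi eps sigma b s) =
  m * erf (m / a) + a / sqrt PI * exp (- (m / a) ^ 2) - b * erf (m / a).
Proof.
move=> Ha Hs Hm.
(* After the tilt, the [b] terms on the positive side are a difference of the densities of means -m
   and m. Their [normal_cdf] parts cancel at +oo, where both tend to 1/2, and at 0 they differ by
   [erf (m / a)], hence the last term of the result. *)
rewrite (RInt_line_split_at_0 _
  (fun x => - normal_moment m a x) (fun x => - (x * normal_pdf m a x))
  (fun x => normal_moment m a x + b * (normal_cdf (- m) a x - normal_cdf m a x))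
  (fun x => x * normal_pdf m a x + b * (normal_pdf (- m) a x - normal_pdf m a x))
  (- - (m / 2)) (m / 2 + b * (1 / 2 - 1 / 2))).
- rewrite normal_moment_at_0 // !normal_cdf_at_0.
  rewrite (_ : - m / a = - (m / a)); last by rewrite /Rdiv; ring.
  by rewrite erf_opp; field; have := sqrt_PI_pos; lra.
- by move=> x Hx; rewrite /phi; case: Rle_dec => [_|]; [ring | lra].
- move=> x Hx; rewrite /phi; case: Rle_dec => [|_]; first lra.
  rewrite -normal_pdf_tilt //.
  rewrite (_ : - 2 * eps * x / sigma = - (4 * m / a ^ 2) * x); first ring.
  (* Solving the hypothesis for [eps] turns the rate 2 eps / sigma into the tilt rate 4 m / a^2. *)
  rewrite (_ : eps = 2 * m * sigma / a ^ 2); first by field; lra.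
  by rewrite Hm; field; lra.
- by move=> x; apply: is_derive_opp; exact: is_derive_normal_moment.
- move=> x; apply: is_derive_plus; first exact: is_derive_normal_moment.
  apply: is_derive_scal; apply: is_derive_minus; exact: is_derive_normal_cdf.
- by move=> x; apply: continuous_opp; exact: continuous_mul_normal_pdf.
- move=> x; apply: continuous_plus; first exact: continuous_mul_normal_pdf.
  apply: continuous_scal_r; apply: continuous_minus; exact: continuous_normal_pdf.
- exact: (is_lim_opp _ _ _ (is_lim_normal_moment_m m a Ha)).
- apply: is_lim_plus'; first exact: is_lim_normal_moment_p.
  apply: (is_lim_scal_l _ b _ (1 / 2 - 1 / 2)).
  by apply: is_lim_minus'; exact: is_lim_normal_cdf_p.
Qed.

(** * Closed form of the rescaled solution *)

Lemma Phi_normal_pdf (eps z t s : R) : 0 < kappa eps -> t < 0 ->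
  Phi eps (z - s) t = normal_pdf z (sqrt (- 2 * kappa eps * t)) s.
Proof.
move=> Hk Ht.
(* The variance -kappa t of [Phi] must equal a^2 / 2, which fixes a. *)
have Hv : 0 < - 2 * kappa eps * t by nra.
rewrite /Phi /normal_pdf -sqrt_mult_alt; last by have := PI_RGT_0; lra.
rewrite (_ : PI * (- 2 * kappa eps * t) = - 2 * PI * kappa eps * t); last by ring.
congr (_ * exp _).
have Hq := sqrt_lt_R0 _ Hv.
rewrite (_ : ((s - z) / sqrt (- 2 * kappa eps * t)) ^ 2 =
             (s - z) ^ 2 / (sqrt (- 2 * kappa eps * t) ^ 2)); last by field; lra.
rewrite pow2_sqrt; last lra.
by field; lra.
Qed.

(* The value of [u / sqrt T], with [q] for [sqrt kappa] and [beta] for [eps * b]. *)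
Definition rescaled_u (gamma q beta : R) : R :=
  q / sqrt PI * exp (- (gamma / q) ^ 2) + gamma * erf (gamma / q)
  + (beta / gamma - gamma) * erf (gamma / (sqrt 2 * q))
  - sqrt 2 * q / sqrt PI * exp (- (gamma / (sqrt 2 * q)) ^ 2).

(** The first expectation has mean 2 eps T and scale 2 sqrt(kappa T), the second mean eps T and
    scale sqrt(2 kappa T). As eps sqrt(T) = gamma, the ratios of mean to scale depend only on gamma
    and kappa. *)
Lemma u_eq_rescaled_u (gamma eps T b : R) :
  0 < gamma -> 0 < eps < 1 -> gamma = eps * sqrt T ->
  1 / sqrt T * u eps (kappa eps) b 0 (eps * T, eps * T) (- T) =
  rescaled_u gamma (sqrt (kappa eps)) (eps * b).
Proof.
move=> Hg He HT.
have Hk : 0 < kappa eps by rewrite /kappa; nra.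
have Hq : 0 < sqrt (kappa eps) by apply sqrt_lt_R0.
have Hr : 0 < sqrt 2 by apply sqrt_lt_R0; lra.
have HP := sqrt_PI_pos.
have HS : sqrt T = gamma / eps by rewrite HT; field; lra.
have HS0 : 0 < sqrt T by rewrite HS; apply Rdiv_lt_0_compat; lra.
have HT0 : 0 < T.
  (* [sqrt] is 0 on nonpositive reals, so [0 < sqrt T] forces [0 < T]. *)
  by case: (Rlt_le_dec 0 T) => // H; move: HS0; rewrite sqrt_neg_0 //; lra.
have HTe : T = (gamma / eps) ^ 2 by rewrite -HS pow2_sqrt //; lra.
have S1 : sqrt (- 2 * kappa eps * (2 * - T)) = 2 * sqrt (kappa eps) * (gamma / eps).
  rewrite (_ : - 2 * kappa eps * (2 * - T) = 2 ^ 2 * kappa eps * T); last by ring.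
  rewrite sqrt_mult_alt; last nra.
  by rewrite sqrt_mult_alt ?sqrt_pow2 ?HS //; lra.
have S2 : sqrt (- 2 * kappa eps * - T) = sqrt 2 * sqrt (kappa eps) * (gamma / eps).
  rewrite (_ : - 2 * kappa eps * - T = 2 * kappa eps * T); last by ring.
  rewrite sqrt_mult_alt; last nra.
  by rewrite sqrt_mult_alt ?HS //; lra.
have Hge : 0 < gamma / eps by apply Rdiv_lt_0_compat; lra.
have A1 : 0 < sqrt (- 2 * kappa eps * (2 * - T)).
  by rewrite S1; repeat (apply Rmult_lt_0_compat => //); lra.
have A2 : 0 < sqrt (- 2 * kappa eps * - T).
  by rewrite S2; repeat (apply Rmult_lt_0_compat => //).
rewrite /u /uh /un /phi_hat /=.
rewrite (RInt_line_ext _ (fun s =>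
  normal_pdf (eps * T + eps * T) (sqrt (- 2 * kappa eps * (2 * - T))) s * Rabs s)); last first.
  by move=> s; rewrite Phi_normal_pdf //; lra.
rewrite (RInt_line_ext (fun s => Phi _ _ _ * phi _ _ _ _) (fun s =>
  normal_pdf (eps * T) (sqrt (- 2 * kappa eps * - T)) s * phi eps (kappa eps) b s)); last first.
  by move=> s; rewrite Phi_normal_pdf //; lra.
rewrite RInt_line_normal_abs // RInt_line_normal_phi //; last first.
(* The tilt condition: with sigma = kappa, m = eps T and a^2 = 2 kappa T, both sides are 2 eps kappa
   T. *)
- by rewrite pow2_sqrt; [ring | nra].
- by apply Rgt_not_eq.
(* At time -T the drift brings xi^r = eps T exactly to the kink, where [phi] vanishes. *)
rewrite (_ : phi eps (kappa eps) b (eps * T + eps * - T) = 0); last first.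
  by rewrite /phi; case: Rle_dec => [_|]; [ring | lra].
have D1 : (eps * T + eps * T) / sqrt (- 2 * kappa eps * (2 * - T)) = gamma / sqrt (kappa eps).
  by rewrite S1 HTe; field; lra.
have D2 : eps * T / sqrt (- 2 * kappa eps * - T) = gamma / (sqrt 2 * sqrt (kappa eps)).
  by rewrite S2 HTe; field; lra.
rewrite D1 D2 S1 S2 HS /rescaled_u HTe.
by field; lra.
Qed.

(** * Passage to the limit *)

Lemma rescaled_u_1 (gamma : R) : rescaled_u gamma 1 1 = c gamma.
Proof.
have Hr : 0 < sqrt 2 by apply sqrt_lt_R0; lra.
rewrite /rescaled_u /c !Rmult_1_r sqrt_div_alt; last exact: PI_RGT_0.
rewrite (_ : gamma / 1 = gamma); last by field.
rewrite (_ : - (gamma / sqrt 2) ^ 2 = - gamma ^ 2 / 2) //.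
(* Only the denominator 2 on the right becomes (sqrt 2)^2, so that [field] can treat sqrt 2 as an
   atom. *)
rewrite -{2}[2]pow2_sqrt; last lra.
by field; lra.
Qed.

Theorem mainTheorem4 (gamma : R) (hgamma : 0 < gamma)
  (T : R -> R)
  (hT : forall eps : R, 0 < eps < 1 -> gamma = eps * sqrt (T eps))
  (b : R -> R)
  (hb : forall eps : R, 0 < eps < 1 -> 0 < b eps)
  (hblim : filterlim (fun eps : R => eps * b eps) (at_right 0) (locally 1)) :
  filterlim
    (fun eps : R =>
       1 / sqrt (T eps)
       * u eps (kappa eps) (b eps) 0 (eps * T eps, eps * T eps) (- T eps))
    (at_right 0) (locally (c gamma)).
Proof.
have Hr : 0 < sqrt 2 by apply sqrt_lt_R0; lra.
(* [rescaled_u] is affine in [beta]. Splitting off the linear term isolates [eps * b eps], known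
   only through its limit, from continuous functions of sqrt(kappa). *)
apply: (filterlim_ext_loc (fun eps =>
    rescaled_u gamma (sqrt (kappa eps)) 0 +
    eps * b eps * (/ gamma * erf (gamma / (sqrt 2 * sqrt (kappa eps)))))).
  (* Radius 1 on the right of 0 gives exactly 0 < eps < 1. *)
  exists (mkposreal 1 Rlt_0_1) => eps Heps Heps0.
  move: Heps; rewrite /ball /= /AbsRing_ball /abs /minus /plus /opp /= => /Rabs_def2 [H _].
  have He : 0 < eps < 1 by lra.
  rewrite (u_eq_rescaled_u gamma _ _ _ hgamma He (hT _ He)).
  by rewrite /rescaled_u /Rdiv; ring.
have -> : c gamma = rescaled_u gamma (sqrt (kappa 0)) 0 +
    1 * (/ gamma * erf (gamma / (sqrt 2 * sqrt (kappa 0)))).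
  rewrite -rescaled_u_1 /kappa pow_ne_zero // Rminus_0_r sqrt_1.
  by rewrite /rescaled_u /Rdiv; ring.
have Hq : continuous (fun eps => sqrt (kappa eps)) 0.
  by apply: ex_derive_continuous; rewrite /kappa; auto_derive; rewrite /=; lra.
have Hq1 : sqrt (kappa 0) = 1 by rewrite /kappa pow_ne_zero // Rminus_0_r sqrt_1.
(* The two [erf] terms correspond to d = 1 and d = sqrt 2. *)
have Hdiv (d : R) : 0 < d -> continuous (fun q => gamma / (d * q)) 1.
  by move=> Hd; apply: ex_derive_continuous; auto_derive; lra.
have Herf (d : R) : 0 < d -> continuous (fun q => erf (gamma / (d * q))) 1.
  move=> Hd; apply: (continuous_comp (fun q => gamma / (d * q)) erf); first exact: Hdiv.
  exact: continuous_erf.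
(* Since kappa extends continuously to eps = 0 with value 1, continuity in q at 1 yields the
   one-sided limit. *)
have right_of (f : R -> R) : continuous f 1 ->
    filterlim (fun eps => f (sqrt (kappa eps))) (at_right 0) (locally (f (sqrt (kappa 0)))).
  move=> Hf.
  have Hc : continuous (fun eps => f (sqrt (kappa eps))) 0.
    by apply: (continuous_comp _ f) => //; rewrite Hq1.
  by move=> P HP; apply filter_le_within; exact: Hc.
have HE : continuous (fun q => rescaled_u gamma q 0) 1.
  rewrite /rescaled_u.
  apply: continuous_minus.
    apply: continuous_plus.
      apply: continuous_plus.
        apply: ex_derive_continuous; auto_derive; lra.
      apply: continuous_scal_r.
      apply: continuous_ext (Herf 1 Rlt_0_1) => q.
      by rewrite Rmult_1_l.
    by apply: continuous_scal_r; apply: Herf.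
  apply: ex_derive_continuous; auto_derive; lra.
have HB : continuous (fun q => / gamma * erf (gamma / (sqrt 2 * q))) 1.
  by apply: continuous_scal_r; apply: Herf.
apply: (filterlim_comp_2 _ _ Rplus (right_of _ HE)); last exact: filterlim_plus.
apply: (filterlim_comp_2 _ _ Rmult hblim (right_of _ HB)).
exact: filterlim_mult.
Qed.
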